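(* Let $S$ be a closed symmetric operator in a separable Hilbert space $\mathfrak H$, let $\Gamma:\mathfrak H^2\to\mathcal H^2$ be a boundary relation for $S^*$ which satisfies the conditions (B1)–(B3), let $\gamma(\lambda)$ be the corresponding $\gamma$-field, let $\mathcal H=\mathcal H_1\oplus\mathcal H_2$ be an orthogonal decomposition, decompose the corresponding Weyl function accordingly as $M(\lambda)=(M_{ij}(\lambda))_{i,j=1}^2$, and let $T\in[\mathcal H_2,\mathcal H_1]$. For $\widehat h=\{h,h'\}\in\mathcal H^2$ write $h=h_1\oplus h_2$, $h'=h_1'\oplus h_2'$ with $h_j,h_j'\in\mathcal H_j$. Then: (i) the linear relation $$H_T=\{\widehat f\in S^*:\{\widehat f,\widehat h\}\in\Gamma\text{ for some }\widehat h\text{ with }h=0,\ h_2'=-T^*h_1'\}$$ is closed and symmetric in $\mathfrak H$ and has equal defect numbers; (ii) the linear relation $\Gamma_T:\mathfrak H^2\to\mathcal H_2^2$ given by $$\Gamma_T=\Big\{\Big\{\widehat f,\begin{pmatrix}h_2\\ T^*h_1'+h_2'\end{pmatrix}\Big\}:\{\widehat f,\widehat h\}\in\Gamma,\ h_1=Th_2\Big\}$$ is a boundary relation for $H_T^*$ which satisfies the conditions (B1)–(B3); (iii) $\operatorname{dom}\Gamma_T=\{\widehat f\in S^*:\{\widehat f,\widehat h\}\in\Gamma\text{ for some }\widehat h\text{ with }h_1=Th_2\}$; (iv) the $\gamma$-field $\gamma_T(\lambda):\mathcal H_2\to\mathfrak H$ corresponding to $\Gamma_T$ is given by $$\gamma_T(\lambda)=\gamma_1(\lambda)T+\gamma_2(\lambda),$$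 where $\gamma(\lambda)=\begin{pmatrix}\gamma_1(\lambda)&\gamma_2(\lambda)\end{pmatrix}:\mathcal H_1\oplus\mathcal H_2\to\mathfrak H$ is decomposed according to $\mathcal H=\mathcal H_1\oplus\mathcal H_2$; (v) the Weyl function $M_T(\lambda)$ associated to $\Gamma_T$ is $$M_T(\lambda)=T^*M_{11}(\lambda)T+T^*M_{12}(\lambda)+M_{21}(\lambda)T+M_{22}(\lambda).$$
   Context: A linear relation from $\mathfrak H_1$ to $\mathfrak H_2$ is a linear subspace of $\mathfrak H_1\times\mathfrak H_2$; $[\mathcal H_2,\mathcal H_1]$ denotes the bounded everywhere defined operators from $\mathcal H_2$ to $\mathcal H_1$, $[\mathcal H]=[\mathcal H,\mathcal H]$. Write $\widehat f=\{f,f'\}$ etc.; pairs are also written as columns. $S^*$ is the adjoint linear relation. Boundary relation: for a closed symmetric linear relation $S$ in $\mathfrak H$, a linear relation $\Gamma:\mathfrak H^2\to\mathcal H^2$ is a boundary relation for $S^*$ if (G1) $\operatorname{dom}\Gamma$ is dense in $S^*$ and $(f',g)_{\mathfrak H}-(f,g')_{\mathfrak H}=(h',k)_{\mathcal H}-(h,k')_{\mathcal H}$ (Green's identity) for all $\{\widehat f,\widehat h\},\{\widehat g,\widehat k\}\in\Gamma$; (G2) every $\{\widehat g,\widehat k\}\in\mathfrak H^2\times\mathcal H^2$ satisfying this identity for all $\{\widehat f,\widehat h\}\in\Gamma$ belongs to $\Gamma$. Put $\Gamma_0=\{\{\widehat f,h\}:\{\widehat f,\widehat h\}\in\Gamma,\widehat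 h=\{h,h'\}\}$. The Weyl family is $M(\lambda)=\{\widehat h\in\mathcal H^2:\{\widehat f_\lambda,\widehat h\}\in\Gamma\text{ for some }\widehat f_\lambda=\{f,\lambda f\}\}$ and the $\gamma$-field is $\gamma(\lambda)=\{\{h,f_\lambda\}:\{\{f_\lambda,\lambda f_\lambda\},\{h,h'\}\}\in\Gamma\text{ for some }h'\}$, $\lambda\in\mathbb C\setminus\mathbb R$. Conditions (B1)–(B3): (B1) Green's identity holds; (B2) $\operatorname{ran}\Gamma_0=\mathcal H$; (B3) $A_0:=\ker\Gamma_0$ is a selfadjoint linear relation in $\mathfrak H$. Under these conditions $M(\lambda)\in[\mathcal H]$ and $\gamma(\lambda)$ is a bounded everywhere defined operator from $\mathcal H$ to $\mathfrak H$ for every $\lambda\in\mathbb C\setminus\mathbb R$. *)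

(* Defs.v *)
From HB Require Import structures.
From mathcomp Require Import all_boot all_order all_algebra complex.
From mathcomp Require Import all_classical all_reals all_analysis.
Set Implicit Arguments.
Unset Strict Implicit.
Unset Printing Implicit Defensive.
Import Order.TTheory GRing.Theory Num.Theory.
Import numFieldNormedType.Exports.
Local Open Scope classical_set_scope.
Local Open Scope ring_scope.
Local Open Scope complex_scope.

(* The inner product is linear in its first argument and conjugate-linear in
   its second one; the norm takes its values in R[i]. *)
HB.mixin Record CompleteNormedModule_isHilbert (R : realType) H
    of CompleteNormedModule R[i] H := {
  inner : {dot H for (@Num.conj R[i])} ;
  norm_inner : forall x : H, `|x| ^+ 2 = inner x x
}.

#[short(type="hilbertType")]
HB.structure Definition Hilbert (R : realType) :=
  { H of CompleteNormedModule_isHilbert R H & CompleteNormedModule R[i] H }.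

(* Separability in the sense of a countable dense subset; the library only has
   second countability. *)
Definition separable_space (T : topologicalType) : Prop :=
  exists2 D : set T, countable D & dense D.

Section LinearRelations.
Context {R : realType}.

(* A linear relation from H to K is a set (H * K) satisfying
   [linear_relation]; an operator is identified with its graph. *)
Definition linear_relation (H K : lmodType R[i]) (A : set (H * K)) : Prop :=
  GRing.submod_closed (mem A).

Definition graph (H K : Type) (f : H -> K) : set (H * K) :=
  [set p | p.2 = f p.1].

Definition rdom (H K : Type) (A : set (H * K)) : set H :=
  [set x | exists y, A (x, y)].

Definition rran (H K : Type) (A : set (H * K)) : set K :=
  [set y | exists x, A (x, y)].

Definition rker (H : Type) (K : nmodType) (A : set (H * K)) : set H :=
  [set x | A (x, 0)].

Definition single_valued (H K : Type) (A : set (H * K)) : Prop :=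
  forall x y z, A (x, y) -> A (x, z) -> y = z.

(* The everywhere defined operator whose graph is A; the value 0 is only taken
   outside the domain of A. *)
Definition operator_of (H K : hilbertType R) (A : set (H * K)) : H -> K :=
  fun x => xget 0 [set y | A (x, y)].

Definition adjoint (H K : hilbertType R) (A : set (H * K)) : set (K * H) :=
  [set q | forall p, A p -> inner p.2 q.1 = inner p.1 q.2].

Definition adjoint_op (H K : hilbertType R) (T : H -> K) : K -> H :=
  operator_of (adjoint (graph T)).

Definition symmetric_relation (H : hilbertType R) (A : set (H * H)) : Prop :=
  A `<=` adjoint A.

Definition selfadjoint_relation (H : hilbertType R) (A : set (H * H)) : Prop :=
  A = adjoint A.

(* For a closed subspace N, an orthonormal basis is a maximal orthonormal
   subset of N. *)
Definition orthonormal_basis (H : hilbertType R) (N E : set H) : Prop :=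
  [/\ E `<=` N,
      forall x, E x -> inner x x = 1,
      forall x y, E x -> E y -> x <> y -> inner x y = 0 &
      forall x, N x -> (forall e, E e -> inner x e = 0) -> x = 0].

Definition same_hilbert_dim (H : hilbertType R) (N N' : set H) : Prop :=
  exists E E', [/\ orthonormal_basis N E, orthonormal_basis N' E' & (E #= E')%card].

Definition defect_subspace (H : hilbertType R) (A : set (H * H)) (l : R[i]) :
    set H :=
  [set f | adjoint A (f, l *: f)].

(* For a symmetric A the dimension of the defect subspace is constant on each
   of the two open half-planes, and these constants are the defect numbers. *)
Definition equal_defect_numbers (H : hilbertType R) (A : set (H * H)) : Prop :=
  forall l : R[i], 0 < complex.Im l ->
    same_hilbert_dim (defect_subspace A l) (defect_subspace A (Num.conj l)).

End LinearRelations.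

Section BoundaryRelations.
Context {R : realType} {F H : hilbertType R}.
Implicit Type G : set ((F * F) * (H * H)).

Definition green (f g : F * F) (h k : H * H) : Prop :=
  inner f.2 g.1 - inner f.1 g.2 = inner h.2 k.1 - inner h.1 k.2.

Definition green_identity G : Prop :=
  forall f h g k, G (f, h) -> G (g, k) -> green f g h k.

Definition boundary_relation (S : set (F * F)) G : Prop :=
  [/\ linear_relation G,
      rdom G `<=` adjoint S /\ adjoint S `<=` closure (rdom G),
      green_identity G &
      forall g k, (forall f h, G (f, h) -> green f g h k) -> G (g, k)].

Definition Gamma0 G : set ((F * F) * H) :=
  [set p | exists h', G (p.1, (p.2, h'))].

Definition condition_B G : Prop :=
  [/\ green_identity G,
      rran (Gamma0 G) = setT &
      selfadjoint_relation (rker (Gamma0 G))].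

Definition weyl_family G (l : R[i]) : set (H * H) :=
  [set h | exists f, G ((f, l *: f), h)].

Definition gamma_field G (l : R[i]) : set (H * F) :=
  [set p | exists h', G ((p.2, l *: p.2), (p.1, h'))].

(* The operators M(l) and gamma(l), for G such that the Weyl family and the
   gamma-field are everywhere defined and single-valued (as they are for l
   nonreal under [condition_B]). *)
Definition weyl_function G (l : R[i]) : H -> H :=
  operator_of (weyl_family G l).

Definition gamma_op G (l : R[i]) : H -> F := operator_of (gamma_field G l).

End BoundaryRelations.

(* H = H1 (+) H2, the summands being Hilbert spaces identified with orthogonal
   subspaces of H through the isometries [in1] and [in2]; [pr1] and [pr2] are
   the components of a vector, so that h = h_1 (+) h_2 reads h_j = pr_j h. *)
Record orthogonal_decomposition (R : realType) (H H1 H2 : hilbertType R) := {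
  in1 : {linear H1 -> H} ;
  in2 : {linear H2 -> H} ;
  pr1 : {linear H -> H1} ;
  pr2 : {linear H -> H2} ;
  inner_in1 : forall x y, inner (in1 x) (in1 y) = inner x y ;
  inner_in2 : forall x y, inner (in2 x) (in2 y) = inner x y ;
  inner_in12 : forall x y, inner (in1 x) (in2 y) = 0 ;
  in_pr : forall h, in1 (pr1 h) + in2 (pr2 h) = h
}.

Section Transform.
Context {R : realType} {F H H1 H2 : hilbertType R}.
Variables (D : orthogonal_decomposition H H1 H2).
Variables (S : set (F * F)) (G : set ((F * F) * (H * H))) (T : H2 -> H1).

Definition relation_HT : set (F * F) :=
  [set f | adjoint S f /\ exists h h', [/\ G (f, (h, h')),
     h = 0 & pr2 D h' = - adjoint_op T (pr1 D h')]].

Definition Gamma_T : set ((F * F) * (H2 * H2)) :=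
  [set p | exists h h', [/\ G (p.1, (h, h')), pr1 D h = T (pr2 D h) &
     p.2 = (pr2 D h, adjoint_op T (pr1 D h') + pr2 D h')]].

Definition gamma1 (l : R[i]) : H1 -> F := gamma_op G l \o in1 D.
Definition gamma2 (l : R[i]) : H2 -> F := gamma_op G l \o in2 D.

Definition M11 (l : R[i]) : H1 -> H1 := pr1 D \o weyl_function G l \o in1 D.
Definition M12 (l : R[i]) : H2 -> H1 := pr1 D \o weyl_function G l \o in2 D.
Definition M21 (l : R[i]) : H1 -> H2 := pr2 D \o weyl_function G l \o in1 D.
Definition M22 (l : R[i]) : H2 -> H2 := pr2 D \o weyl_function G l \o in2 D.

End Transform.

(* Main.v *)
Require Import Defs.
From mathcomp Require Import all_boot all_order all_algebra complex.
From mathcomp Require Import ring lra.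
From mathcomp Require Import all_classical all_reals all_analysis.
Import Order.TTheory GRing.Theory Num.Theory.
Import numFieldNormedType.Exports.
Local Open Scope classical_set_scope.
Local Open Scope ring_scope.
Local Open Scope complex_scope.

(** The transformed relation inherits the conditions (B1)-(B3), and a linear
    relation satisfying (B1)-(B3) is automatically a boundary relation for the
    adjoint of its own kernel; everything else is read off from this.

    Inheritance is short. Green's identity survives because the coupling
    [h_1 = T h_2] and the combination [T^* h_1' + h_2'] are dual to each other;
    the first boundary value [h_2] is reached from [T h_2 (+) h_2]; and when
    [h_2 = 0] the coupling gives [h = 0], so the kernel of the first boundary
    value is the same selfadjoint relation [A0] before and after the
    transformation. The relation [H_T] is the kernel of [Gamma_T], hence a
    restriction of [A0].

    For a linear relation [G] with (B1)-(B3) and kernel [K], maximality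
    ([condition_B_maximal]) follows by removing the first boundary value,
    landing in [A0^* = A0], and removing the second one. Maximality makes [K]
    the adjoint of [dom G], so [K] is closed. To see that [dom G] is dense in
    [K^*] ([rdom_dense_adjoint_rker]), split an element of [K^*] along [A0] into
    a part in [A0] and a part [{n, l n}]; the component of [n] orthogonal to the
    range of the gamma-field has the form [y - l^* x] with [{x, y}] in [A0], and
    Green's identity places [{x, y}] in [K], so the component vanishes. Equality
    of the defect numbers comes from the Cayley transform of [A0], a unitary map
    carrying one defect subspace of [K] onto the other.

    The Hilbert space tools behind this are the projection theorem, the
    representation of bounded functionals (giving [T^*] on the whole space), and
    the surjectivity of [A - l] for selfadjoint [A] and nonreal [l]. The norm
    takes its values in [R[i]], so estimates are carried out with the real
    numbers [nsq x] and [csq a], the squared norm of a vector and the squared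
    modulus of a scalar. *)

(** * Squared moduli and squared norms *)

Section SquaredModulus.
Context {R : realType}.
Implicit Types a b : R[i].

Definition csq a : R := complex.Re a ^+ 2 + complex.Im a ^+ 2.

Lemma csq0 : csq 0 = 0.
Proof. by rewrite /csq /= expr0n addr0. Qed.

Lemma csq_ge0 a : 0 <= csq a.
Proof. by rewrite addr_ge0 ?sqr_ge0. Qed.

Lemma csq_eq0 a : csq a <= 0 -> a = 0.
Proof.
case: a => [p q]; rewrite /csq /= => h.
have p0 : p ^+ 2 = 0.
  by apply/eqP; rewrite eq_le sqr_ge0; have := sqr_ge0 q; lra.
have q0 : q ^+ 2 = 0.
  by apply/eqP; rewrite eq_le sqr_ge0; have := sqr_ge0 p; lra.
by move/eqP: p0; move/eqP: q0; rewrite !sqrf_eq0 => /eqP-> /eqP->.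
Qed.

Lemma csqD_le a b : csq (a + b) <= 2 * (csq a + csq b).
Proof.
case: a b => [p q] [r s]; rewrite /csq /=.
have := sqr_ge0 (p - r); have := sqr_ge0 (q - s); nra.
Qed.

Lemma le_eps_le0 (s C : R) : (forall e, 0 < e -> s <= C * e) -> s <= 0.
Proof.
move=> sC; rewrite leNgt; apply/negP => s0.
have d0 : 0 < 2 * `|C| + 1 by have := normr_ge0 C; lra.
have := sC _ (divr_gt0 s0 d0); rewrite mulrA ler_pdivlMr //.
have := ler_norm C; nra.
Qed.

End SquaredModulus.

Section InnerProduct.
Context {R : realType} {H : hilbertType R}.
Implicit Types (x y z : H) (a : R[i]).

Lemma innerDl x y z : inner (x + y) z = inner x z + inner y z.
Proof. exact: linearDl. Qed.
Lemma innerBl x y z : inner (x - y) z = inner x z - inner y z.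
Proof. exact: linearBl. Qed.
Lemma innerZl a x y : inner (a *: x) y = a * inner x y.
Proof. exact: linearZl_LR. Qed.
Lemma inner0l x : inner 0 x = 0.
Proof. exact: linear0l. Qed.
Lemma innerDr x y z : inner z (x + y) = inner z x + inner z y.
Proof. exact: linearDr. Qed.
Lemma innerBr x y z : inner z (x - y) = inner z x - inner z y.
Proof. exact: linearBr. Qed.
Lemma innerNr x y : inner x (- y) = - inner x y.
Proof. exact: linearNr. Qed.
Lemma innerZr a x y : inner x (a *: y) = Num.conj a * inner x y.
Proof. exact: linearZr_LR. Qed.
Lemma inner0r x : inner x 0 = 0.
Proof. exact: linear0r. Qed.
Lemma innerC x y : inner x y = Num.conj (inner y x).
Proof. by rewrite hermC expr0 mul1r. Qed.

Definition nsq x : R := complex.Re (inner x x).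

Lemma inner_nsq x : inner x x = (nsq x)%:C.
Proof.
by rewrite /nsq RRe_real //; apply: ger0_real; apply: dnorm_ge0.
Qed.

Lemma nsq_ge0 x : 0 <= nsq x.
Proof. by rewrite -ler0c -inner_nsq dnorm_ge0. Qed.

Lemma nsq0_eq0 x : nsq x = 0 -> x = 0.
Proof. by move=> x0; apply/eqP; rewrite -(dnorm_eq0 inner) inner_nsq x0. Qed.

Lemma nsqD x y : nsq (x + y) = nsq x + nsq y + 2 * complex.Re (inner x y).
Proof.
rewrite /nsq innerDl !innerDr (innerC y x).
case: (inner x x) (inner y y) (inner x y) => [a b] [c d] [e f] /=; ring.
Qed.

Lemma nsqN x : nsq (- x) = nsq x.
Proof. by rewrite /nsq (hnormN inner). Qed.

Lemma nsqBC x y : nsq (x - y) = nsq (y - x).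
Proof. by rewrite -nsqN opprB. Qed.

Lemma nsqB x y : nsq (x - y) = nsq x + nsq y - 2 * complex.Re (inner x y).
Proof.
by rewrite nsqD nsqN innerNr; case: (inner x y) => [a b] /=; rewrite mulrN.
Qed.

Lemma nsqZ a x : nsq (a *: x) = csq a * nsq x.
Proof.
rewrite {1}/nsq innerZl innerZr inner_nsq /csq; case: a => [a b] /=; ring.
Qed.

Lemma nsqZr (t : R) x : nsq (t%:C *: x) = t ^+ 2 * nsq x.
Proof. by rewrite nsqZ /csq /= expr0n addr0. Qed.

Lemma nsqD_le x y : nsq (x + y) <= 2 * (nsq x + nsq y).
Proof. by have := nsq_ge0 (x - y); rewrite nsqB nsqD; lra. Qed.

Lemma nsq_triangle x y z : nsq (x - z) <= 2 * (nsq (x - y) + nsq (y - z)).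
Proof.
have -> : x - z = (x - y) + (y - z) by rewrite addrA subrK.
exact: nsqD_le.
Qed.

Lemma CauchySchwarz_csq x y : csq (inner x y) <= nsq x * nsq y.
Proof.
have [y0|yn0] := eqVneq (nsq y) 0.
  by rewrite y0 mulr0 (nsq0_eq0 _ y0) inner0r csq0.
have y_gt0 : 0 < nsq y by rewrite lt_def yn0 nsq_ge0.
(* The component of [x] orthogonal to [y], scaled by [nsq y]. *)
have := nsq_ge0 ((nsq y)%:C *: x - inner x y *: y).
rewrite nsqB nsqZr nsqZ innerZl innerZr /csq.
case: (inner x y) => [a b] /= h.
rewrite -(ler_pM2l y_gt0).
by move: h; rewrite !(mulr0, mul0r, oppr0, subr0, addr0); lra.
Qed.

(** Minimality of the squared norm along a line forces orthogonality; this is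
    the quantitative form in which the minimum is only attained up to [e]. *)
Lemma near_minimizer_inner x y (d e : R) :
  (forall a, d <= nsq (x - a *: y)) -> nsq x <= d + e ->
  csq (inner x y) <= e * nsq y.
Proof.
move=> dmin xd; have [y0|yn0] := eqVneq (nsq y) 0.
  by rewrite y0 mulr0 (nsq0_eq0 _ y0) inner0r csq0.
have y_gt0 : 0 < nsq y by rewrite lt_def yn0 nsq_ge0.
(* This multiple of [y] is the projection of [x] onto the line of [y]. *)
have := dmin ((nsq y)^-1%:C * inner x y).
rewrite nsqB nsqZ innerZr /csq.
case: (inner x y) => [a b] /=; rewrite !(mul0r, subr0, add0r, addr0) => h.
rewrite -ler_pdivrMr //.
set V := (nsq y)^-1 in h *; have VY : V * nsq y = 1 by rewrite mulVf.
have E : ((V * a) ^+ 2 + (V * b) ^+ 2) * nsq y = V * nsq y * (V * (a ^+ 2 + b ^+ 2)).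
  ring.
by move: h; rewrite E VY; nra.
Qed.

End InnerProduct.

(** The form in which continuity of the inner product is used: an equation
    between inner products passes to limits. Two vectors occur because elements
    of a linear relation are pairs. *)
Lemma inner_eps_eq0 (R : realType) (H K : hilbertType R) (c : R[i]) (a : H) (b : K) :
  (forall e : R, 0 < e -> exists x y,
     [/\ nsq x < e, nsq y < e & c = inner a x + inner b y]) -> c = 0.
Proof.
move=> small; apply: csq_eq0.
apply: (@le_eps_le0 _ _ (2 * (nsq a + nsq b))) => e e0.
have [x [y [xe ye ->]]] := small e e0.
apply: (le_trans (csqD_le _ _)); rewrite -mulrA ler_pM2l //.
have := CauchySchwarz_csq a x; have := CauchySchwarz_csq b y.
have := ler_wpM2l (nsq_ge0 a) (ltW xe); have := ler_wpM2l (nsq_ge0 b) (ltW ye).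
lra.
Qed.

(** * Topology in terms of squared norms *)

Section Topology.
Context {R : realType} {H : hilbertType R}.
Implicit Types (x y : H) (e : R).

Lemma norm_nsq x : `|x| = (Num.sqrt (nsq x))%:C.
Proof.
apply/eqP; rewrite -(eqrXn2 (n := 2)) // ?ler0c ?sqrtr_ge0 //.
by rewrite norm_inner inner_nsq -rmorphXn /= sqr_sqrtr // nsq_ge0.
Qed.

Lemma ball_nsq x y e : 0 < e -> ball x e%:C y <-> nsq (x - y) < e ^+ 2.
Proof.
move=> e0; rewrite -ball_normE /ball_ /= norm_nsq ltcR.
by rewrite -(ltr_sqrt _ (exprn_gt0 2 e0)) sqrtr_sqr gtr0_norm.
Qed.

Lemma pos_realC (r : R[i]) : 0 < r -> exists2 e : R, 0 < e & r = e%:C.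
Proof.
case: r => [a b]; rewrite ltcE /= => /andP[/eqP -> a0]; exists a => //.
Qed.

(** Completeness with the rate at which minimizing and approximating sequences
    are produced below. *)
Lemma nsq_complete (u : nat -> H) (C : R) :
  (forall m n, nsq (u m - u n) <= C * (m.+1%:R^-1 + n.+1%:R^-1)) ->
  exists l, forall e, 0 < e -> exists N, forall n, (N <= n)%N -> nsq (l - u n) < e.
Proof.
move=> uC.
have : cauchy (u @ \oo).
  apply/cauchy_ballP => r /pos_realC[e e0 ->]; near_simpl.
  have [N hN] : exists N : nat, 2 * `|C| / e ^+ 2 < N.+1%:R.
    exists (Num.truncn (2 * `|C| / e ^+ 2)); exact: truncnS_gt.
  have tail n : (N <= n)%N -> n.+1%:R^-1 <= N.+1%:R^-1 :> R.
    by move=> Nn; rewrite lef_pV2 ?posrE ?ltr0n // ler_nat ltnS.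
  exists ([set n | (N <= n)%N], [set n | (N <= n)%N]) => /=.
    by split; exists N.
  move=> [m n] /= [Nm Nn]; apply/ball_nsq => //.
  apply: (le_lt_trans (uC m n)).
  apply: (@le_lt_trans _ _ (`|C| * (N.+1%:R^-1 + N.+1%:R^-1))).
    apply: (le_trans (ler_wpM2r _ (ler_norm C))).
      by rewrite addr_ge0 ?invr_ge0.
    by rewrite ler_wpM2l // lerD // tail.
  rewrite -(ltr_pM2r (ltr0Sn R N)) -mulrA mulrDl mulVf ?pnatr_eq0 //.
  move: hN; rewrite ltr_pdivrMr ?exprn_gt0 //; lra.
move=> /cauchy_cvg /cvg_ex[l /cvg_ballP ul].
exists l => e e0.
have se0 : 0 < Num.sqrt e by rewrite sqrtr_gt0.
have [|N _ hN] := ul (Num.sqrt e)%:C; first by rewrite ltcR.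
exists N => n /hN /ball_nsq; rewrite sqr_sqrtr ?ltW //; exact.
Qed.

Lemma closure_pairP (A : set (H * H)) p :
  closure A p <-> forall e, 0 < e ->
    exists q, [/\ A q, nsq (p.1 - q.1) < e & nsq (p.2 - q.2) < e].
Proof.
split=> [cA e e0|hA B /nbhs_ballP[r /= /pos_realC[e e0 ->] eB]].
  have se0 : 0 < Num.sqrt e by rewrite sqrtr_gt0.
  have [|q [Aq [/ball_nsq q1 /ball_nsq q2]]] := cA (ball p (Num.sqrt e)%:C).
    by apply/nbhs_ballP; exists (Num.sqrt e)%:C => //=; rewrite ltcR.
  by exists q; move: q1 q2; rewrite sqr_sqrtr ?(ltW e0) //; split; auto.
have [q [Aq q1 q2]] := hA _ (exprn_gt0 2 e0).
by exists q; split => //; apply: eB; split; apply/ball_nsq.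
Qed.

End Topology.

(** * Projection theorem and bounded adjoints *)

Section Projection.
Context {R : realType}.

Definition subspace {V : lmodType R[i]} (N : set V) : Prop :=
  N 0 /\ forall a u v, N u -> N v -> N (a *: u + v).

Lemma linear_relationP (V W : lmodType R[i]) (A : set (V * W)) :
  linear_relation A <-> subspace A.
Proof.
split=> -[A0 AP]; split; try by [rewrite inE in A0|rewrite inE].
  by move=> a u v Au Av; apply/set_mem/AP; apply/mem_set.
by move=> a u v /set_mem Au /set_mem Av; apply/mem_set/AP.
Qed.

Section Subspace.
Context {V : lmodType R[i]} {N : set V} (sN : subspace N).

Lemma subspaceZ a u : N u -> N (a *: u).
Proof. by move=> Nu; rewrite -[_ *: _]addr0; apply: sN.2 => //; apply: sN.1. Qed.

Lemma subspaceD u v : N u -> N v -> N (u + v).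
Proof. by move=> Nu Nv; rewrite -[u]scale1r; apply: sN.2. Qed.

Lemma subspaceB u v : N u -> N v -> N (u - v).
Proof.
by move=> Nu Nv; rewrite addrC -scaleN1r; apply: sN.2.
Qed.

End Subspace.

(** No closedness of [N] is assumed, and [p] lies in the closure of [N]: this is
    needed for ranges before they are known to be closed. The vector [p] is the
    limit of a minimizing sequence, which is Cauchy by the parallelogram law. *)
Lemma projection (H : hilbertType R) (N : set H) (x : H) : subspace N ->
  exists p, (forall e, 0 < e -> exists u, N u /\ nsq (p - u) < e) /\
    forall u, N u -> inner (x - p) u = 0.
Proof.
move=> sN; pose D : set R := [set nsq (x - u) | u in N].
have D0 : D !=set0 by exists (nsq (x - 0)), 0 => //; apply: sN.1.
have Dlb : has_lbound D by exists 0 => _ [u _ <-]; apply: nsq_ge0.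
pose d := inf D.
have d_le u : N u -> d <= nsq (x - u) by move=> Nu; apply: ge_inf => //; exists u.
have /choice[u uP] : forall n : nat, exists u, N u /\ nsq (x - u) < d + n.+1%:R^-1.
  move=> n; have n0 : 0 < n.+1%:R^-1 :> R by rewrite invr_gt0 ltr0n.
  by have [_ [u Nu <-] ?] := inf_adherent n0 (conj D0 Dlb); exists u.
have u_cauchy m n : nsq (u m - u n) <= 2 * (m.+1%:R^-1 + n.+1%:R^-1).
  have [Nm um] := uP m; have [Nn un] := uP n.
  (* The midpoint is no closer to [x] than the infimum [d]. *)
  pose w := 2^-1 *: (u m + u n).
  have := d_le w (subspaceZ sN _ _ (subspaceD sN _ _ Nm Nn)).
  have E : (x - u m) + (x - u n) = (2%:R : R)%:C *: (x - w).
    rewrite scalerBr scalerA rmorph_nat mulfV ?pnatr_eq0 // scale1r.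
    by rewrite scaler_nat mulr2n opprD addrACA.
  have := nsqZr 2%:R (x - w); rewrite -E (nsqD (x - u m)).
  have -> : u m - u n = (x - u n) - (x - u m) by rewrite opprB [RHS]addrC addrA subrK.
  rewrite (nsqB (x - u n)) (innerC (x - u n)); case: (inner _ _) => [a b] /=.
  by move: (m.+1%:R^-1) (n.+1%:R^-1) um un => s t; lra.
have [p up] := nsq_complete u _ u_cauchy.
exists p; split=> [e e0|v Nv].
  by have [n /(_ n (leqnn n)) ?] := up e e0; exists (u n); split=> //; case: (uP n).
apply: csq_eq0; apply: (@le_eps_le0 _ _ (4 * nsq v)) => e e0.
have [n1 hn1] := up e e0.
have [n2 hn2] : exists n : nat, e^-1 < n.+1%:R.
  by exists (Num.truncn e^-1); exact: truncnS_gt.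
pose n := maxn n1 n2; have [Nun un] := uP n.
have pn : nsq (u n - p) < e by rewrite nsqBC; apply: hn1; exact: leq_maxl.
have ne : n.+1%:R^-1 <= e.
  rewrite -[e]invrK lef_pV2 ?posrE ?invr_gt0 ?ltr0n //.
  by apply: (le_trans (ltW hn2)); rewrite ler_nat ltnS leq_maxr.
have near1 : csq (inner (x - u n) v) <= e * nsq v.
  apply: (@near_minimizer_inner _ _ _ _ d) => [a|]; last first.
    by rewrite (le_trans (ltW un)) // lerD2l.
  by rewrite -addrA -opprD; apply: d_le; apply: subspaceD => //; apply: subspaceZ.
have near2 := CauchySchwarz_csq (u n - p) v.
have -> : x - p = (x - u n) + (u n - p) by rewrite addrA subrK.
rewrite innerDl; apply: (le_trans (csqD_le _ _)).
have := ler_wpM2r (nsq_ge0 v) (ltW pn); lra.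
Qed.

Lemma orthogonal_eq0 (H : hilbertType R) (x : H) : (forall y, inner x y = 0) -> x = 0.
Proof. by move=> /(_ x); rewrite inner_nsq => -[/nsq0_eq0]. Qed.

(** The kernel of [f] is a closed hyperplane; a vector [w] orthogonal to it
    represents [f] up to a factor. *)
Lemma riesz (H : hilbertType R) (f : H -> R[i]) (C : R) :
  (forall a u v, f (a *: u + v) = a * f u + f v) ->
  (forall x, csq (f x) <= C * nsq x) -> exists z, forall x, f x = inner x z.
Proof.
move=> flin fC.
have f0 : f 0 = 0.
  have /eqP := flin 1 0 0; rewrite scaler0 addr0 mul1r eq_sym.
  by rewrite -subr_eq0 addrK => /eqP.
have fZ a u : f (a *: u) = a * f u by rewrite -[_ *: _]addr0 flin f0 addr0.
have fB u v : f (u - v) = f u - f v.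
  by rewrite addrC -scaleN1r flin mulN1r addrC.
have sK : subspace [set x | f x = 0].
  by split=> [|a u v /= fu fv] //; rewrite flin fu fv mulr0 addr0.
have [[y fy]|fN] := pselect (exists y, f y != 0); last first.
  exists 0 => x; rewrite inner0r; apply/eqP/negPn/negP => fx; apply: fN.
  by exists x.
have [p [pK orth]] := projection _ _ y sK.
have fp : f p = 0.
  apply: csq_eq0; apply: (@le_eps_le0 _ _ `|C|) => e e0.
  have [u [fu pu]] := pK e e0.
  have := fC (p - u); rewrite fB fu subr0 => h; apply: (le_trans h).
  have := ler_wpM2r (nsq_ge0 (p - u)) (ler_norm C).
  have := ler_wpM2l (normr_ge0 C) (ltW pu); lra.
pose w := y - p; have fw : f w != 0 by rewrite fB fp subr0.
have ww : inner w w != 0.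
  by apply: contra_neq fw => /eqP; rewrite (dnorm_eq0 inner) => /eqP ->.
exists ((Num.conj (f w) / inner w w) *: w) => x.
have /orth : [set x | f x = 0] (x - (f x / f w) *: w).
  by rewrite /= fB fZ divfK // subrr.
rewrite innerC innerBl innerZl => /(congr1 Num.conj).
rewrite conjCK conjC0 => /eqP; rewrite subr_eq0 => /eqP xw.
rewrite innerZr rmorphM fmorphV /= conjCK -(innerC w w) xw -/w; field.
exact/andP.
Qed.

Lemma bounded_near_nsq (H K : hilbertType R) (T : {linear H -> K}) :
  bounded_near T (nbhs 0) -> exists C, forall x, nsq (T x) <= C * nsq x.
Proof.
move=> /linear_boundedP /pinfty_ex_gt0[r /pos_realC[e e0 ->] Tr].
exists (e ^+ 2) => x; have := Tr x; rewrite !norm_nsq -rmorphM /= lecR.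
rewrite -(ler_sqr) ?nnegrE ?mulr_ge0 ?sqrtr_ge0 ?(ltW e0) //.
by rewrite exprMn !sqr_sqrtr ?nsq_ge0.
Qed.

(** [adjoint_op T] is chosen among the values of the adjoint relation, so what
    has to be known is that this relation is defined everywhere. *)
Lemma adjoint_opP (H K : hilbertType R) (T : {linear H -> K}) :
  bounded_near T (nbhs 0) ->
  forall x y, inner x (adjoint_op T y) = inner (T x) y.
Proof.
move=> /bounded_near_nsq[C TC] x y.
have [z zP] : exists z, forall x, inner (T x) y = inner x z.
  apply: (@riesz _ _ (C * nsq y)) => [a u v|u].
    by rewrite linearP innerDl innerZl.
  apply: (le_trans (CauchySchwarz_csq _ _)).
  by have := ler_wpM2r (nsq_ge0 y) (TC u); lra.
have : adjoint (graph T) (y, adjoint_op T y).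
  apply: (@xgetI _ 0 [set z | adjoint (graph T) (y, z)] z) => -[u v] uv /=.
  by rewrite (uv : v = T u).
by move=> /(_ (x, T x) erefl).
Qed.

Lemma adjoint_op_linear (H K : hilbertType R) (T : {linear H -> K}) :
  bounded_near T (nbhs 0) ->
  forall a x y, adjoint_op T (a *: x + y) = a *: adjoint_op T x + adjoint_op T y.
Proof.
move=> bT a x y; apply/eqP; rewrite -subr_eq0; apply/eqP.
apply: orthogonal_eq0 => z.
rewrite innerC innerBr innerDr innerZr !(adjoint_opP _ _ _ bT).
by rewrite innerDr innerZr subrr conjC0.
Qed.

Lemma adjoint_op0 (H K : hilbertType R) (T : {linear H -> K}) :
  bounded_near T (nbhs 0) -> adjoint_op T 0 = 0.
Proof.
move=> bT; have := adjoint_op_linear _ _ _ bT (-1) 0 0.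
by rewrite scaler0 addr0 scaleN1r addNr.
Qed.

End Projection.

(** * Adjoints and selfadjoint relations *)

Section Adjoint.
Context {R : realType} {H : hilbertType R}.
Implicit Types (A B : set (H * H)) (l : R[i]).

Lemma adjoint_subspace A : subspace (adjoint A).
Proof.
split=> [p _ /=|a u v Au Av p Ap /=]; first by rewrite !inner0r.
by rewrite !innerDr !innerZr (Au _ Ap) (Av _ Ap).
Qed.

Lemma adjoint_closed A : closed (adjoint A).
Proof.
move=> q /closure_pairP cq p Ap.
apply/eqP; rewrite -subr_eq0; apply/eqP.
apply: (@inner_eps_eq0 _ _ _ _ p.2 (- p.1)) => e e0.
have [u [Au u1 u2]] := cq e e0.
exists (q.1 - u.1), (q.2 - u.2); split=> //.
rewrite !innerBr !(linearNl inner) (Au _ Ap); ring.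
Qed.

Lemma adjointS A B : A `<=` B -> adjoint B `<=` adjoint A.
Proof. by move=> AB q Bq p /AB; apply: Bq. Qed.

Lemma defect_subspaceP A l n :
  defect_subspace A l n <->
  forall x y, A (x, y) -> inner (y - Num.conj l *: x) n = 0.
Proof.
split=> [An x y Axy|An [x y] Axy /=].
  by have := An _ Axy; rewrite innerBl innerZl innerZr /= => ->; rewrite subrr.
have := An _ _ Axy; rewrite innerBl innerZl innerZr.
by move/eqP; rewrite subr_eq0 => /eqP.
Qed.

Section Symmetric.
Context {A : set (H * H)} (symA : symmetric_relation A).

(** The Cayley transform [y - l x |-> y - l^* x] is isometric because symmetry
    makes the cross terms [inner y z] and [inner x w] equal. *)
Lemma cayley_isometry l x y z w : A (x, y) -> A (z, w) ->
  inner (y - l *: x) (w - l *: z) =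
  inner (y - Num.conj l *: x) (w - Num.conj l *: z).
Proof.
move=> Axy Azw; have /= yz := symA _ Azw _ Axy.
rewrite !innerBl !innerBr !innerZl !innerZr yz conjCK; ring.
Qed.

(** [inner y x] is real, so the left-hand side is what remains of
    [nsq (y - l x)] after subtracting [nsq (y - Re l x)]. *)
Lemma symmetric_lower_bound l x y : A (x, y) ->
  complex.Im l ^+ 2 * nsq x <= nsq (y - l *: x).
Proof.
move=> Axy; have /= yx := symA _ Axy _ Axy.
have := nsq_ge0 (y - (complex.Re l)%:C *: x).
have : inner y x = Num.conj (inner y x) by rewrite -innerC.
rewrite !nsqB nsqZr nsqZ !innerZr /csq; case: (inner y x) l => [r s] [a b] /= [s0].
have {}s0 : s = 0 by lra.
rewrite s0; nra.
Qed.

End Symmetric.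

(** The range of [A - l] is dense because a vector [n] orthogonal to it gives
    [{n, l^* n}] in [A^* = A], which the lower bound for symmetric relations
    forbids unless [n = 0]. The same bound turns approximate solutions into a
    Cauchy sequence, whose limit is a solution since [A] is closed. *)
Lemma selfadjoint_range A l z : selfadjoint_relation A -> complex.Im l != 0 ->
  exists x y, A (x, y) /\ y - l *: x = z.
Proof.
move=> saA l0; have symA : symmetric_relation A by rewrite /symmetric_relation -saA.
have sA : subspace A by rewrite saA; apply: adjoint_subspace.
have b0 : 0 < complex.Im l ^+ 2 by rewrite lt_def sqr_ge0 sqrf_eq0 l0.
pose N : set H := [set v | exists x y, A (x, y) /\ y - l *: x = v].
have sN : subspace N.
  split=> [|a _ _ [x [y [Axy <-]]] [x' [y' [Axy' <-]]]].
    by exists 0, 0; split; [apply: sA.1|rewrite scaler0 subr0].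
  exists (a *: x + x'), (a *: y + y'); split; first exact: (sA.2 a _ _ Axy Axy').
  by rewrite scalerBr scalerDr !scalerA opprD addrACA (mulrC l).
have [p [Np orth]] := projection _ _ z sN.
have zp : z = p.
  have An : A (z - p, Num.conj l *: (z - p)).
    rewrite saA; apply/defect_subspaceP => x y Axy; rewrite conjCK innerC orth ?conjC0 //.
    by exists x, y.
  have := symmetric_lower_bound symA (Num.conj l) _ _ An.
  have -> : complex.Im (Num.conj l) = - complex.Im l.
    by case: l {l0 b0 N sN Np orth An}.
  rewrite subrr /nsq inner0l.
  rewrite sqrrN -/(nsq (z - p)) /= => h; apply/eqP; rewrite -subr_eq0; apply/eqP/nsq0_eq0.
  by apply/eqP; rewrite eq_le nsq_ge0 andbT -(pmulr_rle0 _ b0).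
have /choice[w wP] : forall n : nat, exists w : H * H,
    A w /\ nsq (z - (w.2 - l *: w.1)) < n.+1%:R^-1.
  move=> n; have n0 : 0 < n.+1%:R^-1 :> R by rewrite invr_gt0 ltr0n.
  have [_ [[x [y [Axy <-]]] ?]] := Np _ n0.
  by exists (x, y); rewrite zp.
have w_cauchy m n : nsq ((w m).1 - (w n).1) <=
    2 / complex.Im l ^+ 2 * (m.+1%:R^-1 + n.+1%:R^-1).
  have [[Am rm] [An rn]] := (wP m, wP n).
  have := symmetric_lower_bound symA l _ _ (subspaceB sA _ _ Am An).
  have -> : (w m).2 - (w n).2 - l *: ((w m).1 - (w n).1) =
     ((w m).2 - l *: (w m).1) - ((w n).2 - l *: (w n).1).
    by rewrite scalerBr !opprB addrACA [RHS]addrACA; congr (_ + _); apply: addrC.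
  have := nsq_triangle ((w m).2 - l *: (w m).1) z ((w n).2 - l *: (w n).1).
  rewrite (nsqBC _ z) => h1 h2; rewrite mulrAC ler_pdivlMr // mulrC.
  apply: (le_trans h2); apply: (le_trans h1).
  by rewrite ler_pM2l // lerD // ltW.
have [x xP] := nsq_complete _ _ w_cauchy.
exists x, (z + l *: x); split; last by rewrite addrK.
rewrite saA; apply: adjoint_closed; apply/closure_pairP => e e0.
have c0 := csq_ge0 l.
(* Small enough for [2 (d + csq l * d) < e], the bound on the second
   component of the error. *)
pose d := e / (4 * (1 + csq l)).
have d0 : 0 < d by rewrite divr_gt0 //; lra.
have de : 4 * (1 + csq l) * d = e by rewrite /d mulrC divfK // gt_eqF //; lra.
have [n1 hn1] := xP d d0.
have [n2 hn2] : exists n : nat, d^-1 < n.+1%:R.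
  by exists (Num.truncn d^-1); exact: truncnS_gt.
pose n := maxn n1 n2; have [An rn] := wP n.
have xn : nsq (x - (w n).1) < d by apply: hn1; exact: leq_maxl.
have nd : n.+1%:R^-1 <= d.
  rewrite -[d]invrK lef_pV2 ?posrE ?invr_gt0 ?ltr0n //.
  by apply: (le_trans (ltW hn2)); rewrite ler_nat ltnS leq_maxr.
have {}rn := lt_le_trans rn nd.
exists (w n); split=> /=; [by rewrite -saA|nra|].
have -> : z + l *: x - (w n).2 = (z - ((w n).2 - l *: (w n).1)) + l *: (x - (w n).1).
  by rewrite scalerBr opprB addrACA [_ - _ - _]addrAC subrr sub0r.
apply: (le_lt_trans (nsqD_le _ _)); rewrite nsqZ.
have := ler_wpM2l c0 (ltW xn); lra.
Qed.

End Adjoint.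

(** * Defect numbers *)

Section DefectNumbers.
Context {R : realType} {H : hilbertType R}.

(** By Zorn's lemma; a vector left over could be normalized and added. *)
Lemma orthonormal_basis_exists (N : set H) :
  (forall a x, N x -> N (a *: x)) -> exists E, orthonormal_basis N E.
Proof.
move=> NZ.
pose P (E : set H) := [/\ E `<=` N, forall x, E x -> inner x x = 1 &
  forall x y, E x -> E y -> x <> y -> inner x y = 0].
have [F FP totF|E [[EN E1 E0] Emax]] := @Zorn_bigcup _ P.
  split=> [x [X FX Xx]|x [X FX Xx]|x y [X FX Xx] [Y FY Yy]].
  - by have [+ _ _] := FP _ FX; apply.
  - by have [_ + _] := FP _ FX; apply.
  - have [XY|YX] := totF _ _ FX FY.
      by have [_ _ +] := FP _ FY; apply => //; apply: XY.
    by have [_ _ +] := FP _ FX; apply => //; apply: YX.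
exists E; split=> // x Nx xE; apply/eqP/negPn/negP => x0.
have x_gt0 : 0 < nsq x.
  by rewrite lt_def nsq_ge0 andbT; apply: contra_neq x0 => /nsq0_eq0.
pose y := (Num.sqrt (nsq x))^-1%:C *: x.
have y1 : inner y y = 1.
  rewrite inner_nsq nsqZr exprVn sqr_sqrtr ?ltW // mulVf ?gt_eqF //.
have yE e : E e -> inner y e = 0 by move=> Ee; rewrite innerZl xE // mulr0.
apply: (Emax (y |` E)).
  split=> [e Ee|]; first by right.
  move=> /(_ y (or_introl erefl)) /yE; rewrite y1; apply/eqP; exact: oner_neq0.
split=> [_ [->|/EN//]|_ [->//|/E1//]|u v [->|Eu] [->|Ev] uv]; first exact: NZ.
- by [].
- exact: yE.
- by rewrite innerC yE // conjC0.
- exact: E0.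
Qed.

(** A selfadjoint extension [A] makes the Cayley transform of [A] a unitary map
    of the whole space, which carries the range of [B - l^*] onto that of
    [B - l] and hence one defect subspace onto the other. *)
Lemma selfadjoint_extension_equal_defect (A B : set (H * H)) :
  selfadjoint_relation A -> B `<=` A -> equal_defect_numbers B.
Proof.
move=> saA BA l l_gt0; have l0 : complex.Im l != 0 by rewrite gt_eqF.
have lc0 : complex.Im (Num.conj l) != 0.
  by case: l l0 {l_gt0} => [a b] /=; rewrite oppr_eq0.
have symA : symmetric_relation A by rewrite /symmetric_relation -saA.
have /choice[V VP] : forall n, exists v, exists x y,
    [/\ A (x, y), n = y - Num.conj l *: x & v = y - l *: x].
  move=> n; have [x [y [Axy <-]]] := selfadjoint_range _ _ n saA lc0.
  by exists (y - l *: x), x, y.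
have VI n m : inner (V n) (V m) = inner n m.
  have [x [y [Axy nE ->]]] := VP n; have [z [w [Azw mE ->]]] := VP m.
  by rewrite (cayley_isometry symA _ _ _ _ _ Axy Azw) -nE -mE.
have [E [EN E1 E0 Emax]] : exists E, orthonormal_basis (defect_subspace B l) E.
  apply: orthonormal_basis_exists => a x /defect_subspaceP Bx.
  by apply/defect_subspaceP => u v /Bx h; rewrite innerZr h mulr0.
exists E, (V @` E); split; first by split.
  split=> [_ [e Ee <-]|_ [e Ee <-]|_ _ [e Ee <-] [f Ef <-]|m Nm mE].
  - apply/defect_subspaceP => b b' Bb; rewrite conjCK.
    have [x [y [Axy eE ->]]] := VP e.
    rewrite (cayley_isometry symA _ _ _ _ _ (BA _ Bb) Axy) -eE.
    by move/EN/defect_subspaceP: Ee; apply.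
  - by rewrite VI E1.
  - by move=> ef; rewrite VI E0 // => fe; apply: ef; rewrite fe.
  - have [x [y [Axy mE']]] := selfadjoint_range _ _ m saA l0.
    pose n := y - Num.conj l *: x.
    have n0 : n = 0.
      apply: Emax => [|e Ee].
        apply/defect_subspaceP => b b' Bb.
        rewrite -(cayley_isometry symA _ _ _ _ _ (BA _ Bb) Axy) mE'.
        by move/defect_subspaceP: Nm => /(_ _ _ Bb); rewrite conjCK.
      have := mE _ (imageP V Ee); have [z [w [Azw eE ->]]] := VP e.
      by rewrite -mE' (cayley_isometry symA _ _ _ _ _ Axy Azw) -eE.
    apply: nsq0_eq0; have := cayley_isometry symA l _ _ _ _ Axy Axy.
    by rewrite mE' -/n n0 inner0l /nsq => ->.
rewrite card_eq_sym; apply: inj_card_eq => e f /set_mem Ee /set_mem Ef ef.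
apply: contrapT => /(E0 _ _ Ee Ef); rewrite -VI ef VI E1 // => /eqP.
by rewrite oner_eq0.
Qed.

End DefectNumbers.

(** * Boundary relations from conditions (B1)-(B3) *)

Section BoundaryRelation.
Context {R : realType} {F H : hilbertType R}.
Implicit Types (f g : F * F) (h k : H * H) (l : R[i]).

Lemma greenB f g g' h k k' :
  green f g h k -> green f g' h k' -> green f (g - g') h (k - k').
Proof.
rewrite /green /= !innerBr => e e'.
transitivity ((inner f.2 g.1 - inner f.1 g.2) - (inner f.2 g'.1 - inner f.1 g'.2)).
  by ring.
by rewrite e e'; ring.
Qed.

Context {G : set ((F * F) * (H * H))}.
Context (linG : linear_relation G).
Context (condG : condition_B G).

Let sG : subspace G. Proof. exact/linear_relationP. Qed.
Let A0 : set (F * F) := rker (Gamma0 G).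
Let saA0 : selfadjoint_relation A0. Proof. by case: condG. Qed.
Let greenG f h g k : G (f, h) -> G (g, k) -> green f g h k.
Proof. by case: condG => + _ _; apply. Qed.
Let ranG x : exists f x', G (f, (x, x')).
Proof.
case: condG => _ + _ => /(congr1 (fun A => A x)).
by rewrite propeqE => -[_ /(_ I)[f [x' ?]]]; exists f, x'.
Qed.
Let symA0 : symmetric_relation A0.
Proof. by rewrite /symmetric_relation -saA0. Qed.

Lemma boundary_value_eq0 (y : H) :
  (forall f h, G (f, h) -> inner h.1 y = 0) -> y = 0.
Proof.
move=> Gk; apply: orthogonal_eq0 => x; have [f [x' Gf]] := ranG x.
by rewrite innerC (Gk _ _ Gf) conjC0.
Qed.

(** Subtracting from [(g, k)] an element of [G] with the same first boundary
    value, one reaches [A0^* = A0]; an element of [G] over it then leaves only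
    a pure second boundary value, which is orthogonal to [ran Gamma0]. *)
Lemma condition_B_maximal g k :
  (forall f h, G (f, h) -> green f g h k) -> G (g, k).
Proof.
move=> gk; have [f1 [x1 G1]] := ranG k.1.
have : A0 (g - f1).
  rewrite saA0 => -[a a'] [y' Gy] /=.
  have := greenB _ _ _ _ _ _ (gk _ _ Gy) (greenG _ _ _ _ Gy G1).
  rewrite /green /= inner0l subrr inner0r subrr => /eqP.
  by rewrite subr_eq0 => /eqP.
move=> [x2 G2].
have G3 : G (g - f1 + f1, (0 + k.1, x2 + x1)) := subspaceD sG _ _ G2 G1.
rewrite subrK add0r in G3.
have : k.2 - (x2 + x1) = 0.
  apply: boundary_value_eq0 => f h Gf.
  have := greenB _ _ _ _ _ _ (gk _ _ Gf) (greenG _ _ _ _ Gf G3).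
  rewrite /green /= !subrr !inner0r !subrr sub0r => /eqP.
  by rewrite eq_sym oppr_eq0 => /eqP.
by move/eqP; rewrite subr_eq0 => /eqP k2; move: G3; rewrite -k2 -surjective_pairing.
Qed.

(** By maximality, a pair lies in the kernel as soon as Green's identity holds
    for it with the boundary value 0, which is the definition of the adjoint of
    the domain. *)
Lemma rker_adjoint_rdom : rker G = adjoint (rdom G).
Proof.
apply/seteqP; split=> [g Gg f [h Gf]|g gG].
  have := greenG _ _ _ _ Gf Gg.
  by rewrite /green /= !inner0r subrr => /eqP; rewrite subr_eq0 => /eqP.
apply: condition_B_maximal => f h Gf.
by rewrite /green /= !inner0r subrr (gG f) ?subrr //; exists h.
Qed.

Lemma rker_sub_A0 : rker G `<=` A0.
Proof. by move=> f Gf; exists 0. Qed.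

Lemma rker_symmetric : symmetric_relation (rker G).
Proof.
by move=> f /rker_sub_A0/symA0; apply: adjointS; apply: rker_sub_A0.
Qed.

(** Any element of [G] over the first boundary value [x] can be moved into the
    eigenspace at [l] by an element of [A0], since [A0 - l] is surjective. *)
Lemma gamma_field_total l x : complex.Im l != 0 ->
  exists n x', G ((n, l *: n), (x, x')).
Proof.
move=> l0; have [[a b] [x1 G1]] := ranG x.
have [c [d [[x2 G2] cd]]] := selfadjoint_range _ _ (b - l *: a) saA0 l0.
exists (a - c), (x1 - x2).
have : G ((a - c, b - d), (x - 0, x1 - x2)) := subspaceB sG _ _ G1 G2.
rewrite subr0; suff -> : b - d = l *: (a - c) by [].
have -> : b = - (l *: c) + d + l *: a by rewrite [- _ + d]addrC cd subrK.
by rewrite scalerBr [_ + l *: a - d]addrAC addrK addrC.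
Qed.

(** A symmetric relation has no nonreal eigenvalue, which gives [n = 0]; then
    Green's identity makes [x'] orthogonal to [ran Gamma0], the whole space. *)
Lemma gamma_field_ker l n x' : complex.Im l != 0 ->
  G ((n, l *: n), (0, x')) -> n = 0 /\ x' = 0.
Proof.
move=> l0 Gn; have An : A0 (n, l *: n) by exists x'.
have n0 : n = 0.
  have := symmetric_lower_bound symA0 l _ _ An; rewrite subrr {2}/nsq inner0l /=.
  rewrite pmulr_rle0 ?lt_def ?sqr_ge0 ?sqrf_eq0 ?l0 // => h.
  by apply: nsq0_eq0; apply/eqP; rewrite eq_le nsq_ge0 h.
split=> //; apply: boundary_value_eq0 => f h Gf.
have := greenG _ _ _ _ Gf Gn; rewrite n0 /green /= scaler0 !inner0r subrr sub0r.
by move=> /eqP; rewrite eq_sym oppr_eq0 => /eqP.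
Qed.

Lemma rker_subspace : subspace (rker G).
Proof. by rewrite rker_adjoint_rdom; apply: adjoint_subspace. Qed.

(** An element of [(ker G)^*] differs from one of [A0] by some [{n, l n}], and
    [n] lies in the closure of the range [N] of the gamma-field: by Green's
    identity a vector of the defect subspace orthogonal to [N] is also orthogonal
    to itself. *)
Lemma rdom_dense_adjoint_rker : adjoint (rker G) `<=` closure (rdom G).
Proof.
move=> [f f'] Bf; pose l : R[i] := 'i%C; pose B := adjoint (rker G).
have sB : subspace B := adjoint_subspace _.
have l0 : complex.Im l != 0 by rewrite /= oner_neq0.
have lc0 : complex.Im (Num.conj l) != 0 by rewrite /= oppr_eq0 oner_neq0.
have l1 x : nsq (l *: x) = nsq x by rewrite nsqZ /csq /= expr0n expr1n add0r mul1r.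
have [c [d [Acd cd]]] := selfadjoint_range _ _ (f' - l *: f) saA0 l0.
pose n := f - c.
have fd : f' - d = l *: n.
  have -> : f' = - (l *: c) + d + l *: f by rewrite [- _ + d]addrC cd subrK.
  by rewrite /n scalerBr [_ + l *: f - d]addrAC addrK addrC.
have Bcd : B (c, d) by apply: (adjointS _ _ rker_sub_A0); apply: symA0.
have Bn : B (n, l *: n) by rewrite -fd; apply: (subspaceB sB _ _ Bf Bcd).
pose N : set F := [set v | exists h, G ((v, l *: v), h)].
have sN : subspace N.
  split=> [|a u v [h Gu] [k Gv]]; first by exists 0; rewrite scaler0; apply: sG.1.
  exists (a *: h + k); have := sG.2 a _ _ Gu Gv.
  have -> : l *: (a *: u + v) = a *: (l *: u) + l *: v.
    by rewrite scalerDr !scalerA mulrC.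
  exact.
have [p [pN orth]] := projection _ _ n sN.
have Bp : B (p, l *: p).
  apply: adjoint_closed; apply/closure_pairP => e /pN[u [[h Gu] pu]].
  exists (u, l *: u); split=> //=; last by rewrite -scalerBr l1.
  move=> b Gb; have := greenG _ _ _ _ Gb Gu; rewrite /green /= !inner0l subrr.
  by move/eqP; rewrite subr_eq0 => /eqP.
(* Write [q = y - l^* x] with [{x, y}] in [A0] and second boundary value [k'].
   Orthogonality of [q] to [N] kills [k'], so [{x, y}] lies in [ker G], and
   [q], being a defect vector, is orthogonal to [y - l^* x = q]. *)
pose q := n - p.
have Bq : B (q, l *: q) by rewrite scalerBr; apply: (subspaceB sB _ _ Bn Bp).
have q0 : q = 0.
  have [x [y [[k' Gxy] xy]]] := selfadjoint_range _ _ q saA0 lc0.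
  have k0 : k' = 0.
    apply: orthogonal_eq0 => z; have [v [z' Gv]] := gamma_field_total l z l0.
    have := greenG _ _ _ _ Gxy Gv; rewrite /green /= inner0l subr0 => <-.
    rewrite innerZr -innerZl -innerBl xy; apply: orth.
    by exists (z, z').
  move/defect_subspaceP: Bq => /(_ x y); rewrite xy; rewrite inner_nsq.
  by rewrite k0 in Gxy => /(_ Gxy)[/nsq0_eq0].
apply/closure_pairP => e /pN[u [[h Gu] nu]].
have np : n = p by apply/eqP; rewrite -subr_eq0 -/q q0.
have [k' Gcd] := Acd.
exists (c + u, d + l *: u); split=> /=.
- by exists ((0, k') + h); apply: (subspaceD sG _ _ Gcd Gu).
- by rewrite opprD addrA -/n np.
- by rewrite opprD addrA fd -scalerBr l1 np.
Qed.

Lemma condition_B_boundary_relation : boundary_relation (rker G) G.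
Proof.
split; [exact: linG| |exact: greenG|exact: condition_B_maximal].
split; last exact: rdom_dense_adjoint_rker.
move=> f [h Gf] g Gg; have := greenG _ _ _ _ Gg Gf.
by rewrite /green /= !inner0l subrr => /eqP; rewrite subr_eq0 => /eqP.
Qed.

End BoundaryRelation.

(** * Transformation of a boundary relation *)

Section WeylFunction.
Context {R : realType} {F H : hilbertType R} {G : set ((F * F) * (H * H))}.
Context (linG : linear_relation G).
Context (condG : condition_B G).

Lemma weyl_pair_unique (l : R[i]) n m x y z : complex.Im l != 0 ->
  G ((n, l *: n), (x, y)) -> G ((m, l *: m), (x, z)) -> n = m /\ y = z.
Proof.
move=> l0 Gn Gm.
have : G ((n - m, l *: n - l *: m), (x - x, y - z)).
  by apply: (subspaceB _ _ _ Gn Gm); apply/linear_relationP.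
rewrite -scalerBr subrr => /(gamma_field_ker condG _ _ _ l0)[nm yz].
by split; apply/eqP; rewrite -subr_eq0 ?nm ?yz.
Qed.

(** The operators are defined by a choice of values, which uniqueness identifies
    with the values read off from any element of [G]. *)
Lemma weyl_pairE (l : R[i]) n x y : complex.Im l != 0 ->
  G ((n, l *: n), (x, y)) -> gamma_op G l x = n /\ weyl_function G l x = y.
Proof.
move=> l0 Gn; split.
- have [y' Gy'] : gamma_field G l (x, gamma_op G l x).
    by apply: (@xgetI _ 0 [set m | gamma_field G l (x, m)] n); exists y.
  by have [] := weyl_pair_unique _ _ _ _ _ _ l0 Gy' Gn.
- have [m Gm] : weyl_family G l (x, weyl_function G l x).
    by apply: (@xgetI _ 0 [set z | weyl_family G l (x, z)] y); exists n.
  by have [] := weyl_pair_unique _ _ _ _ _ _ l0 Gm Gn.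
Qed.

End WeylFunction.

Section OrthogonalDecomposition.
Context {R : realType} {H H1 H2 : hilbertType R} (D : orthogonal_decomposition H H1 H2).

Lemma inner_pr h k :
  inner h k = inner (pr1 D h) (pr1 D k) + inner (pr2 D h) (pr2 D k).
Proof.
rewrite -{1}(in_pr D h) -{1}(in_pr D k) innerDl !innerDr inner_in1 inner_in2.
by rewrite inner_in12 (innerC (in2 D _)) inner_in12 conjC0 addr0 add0r.
Qed.

(** [in_pr] alone determines the components, because orthogonal summands meet
    only in 0. *)
Lemma pr_in x y : pr1 D (in1 D x + in2 D y) = x /\ pr2 D (in1 D x + in2 D y) = y.
Proof.
set h := in1 D x + in2 D y.
have E : in1 D (pr1 D h - x) + in2 D (pr2 D h - y) = 0.
  by rewrite !linearB addrACA -opprD in_pr subrr.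
split; apply/eqP; rewrite -subr_eq0; apply/eqP/nsq0_eq0.
- have := congr1 (fun v => complex.Re (inner v (in1 D (pr1 D h - x)))) E.
  by rewrite innerDl inner_in1 (innerC (in2 D _)) inner_in12 conjC0 addr0 inner0l.
- have := congr1 (fun v => complex.Re (inner v (in2 D (pr2 D h - y)))) E.
  by rewrite innerDl inner_in2 inner_in12 add0r inner0l.
Qed.

End OrthogonalDecomposition.

Section TransformedRelation.
Context {R : realType} {F H H1 H2 : hilbertType R}.
Context {S : set (F * F)} {G : set ((F * F) * (H * H))}.
Context {D : orthogonal_decomposition H H1 H2} {T : {linear H2 -> H1}}.
Context (linG : linear_relation G).
Context (condG : condition_B G).
Context (bndT : bounded_near T (nbhs 0)).
Let sG : subspace G. Proof. exact/linear_relationP. Qed.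

Lemma Gamma_T_linear : linear_relation (Gamma_T D G T).
Proof.
apply/linear_relationP.
split=> [|a [f p] [g q] [h [h' [Gf hT /= ->]]] [k [k' [Gg kT /= ->]]]].
  exists 0, 0; split; rewrite /= ?linear0 //; first exact: sG.1.
  by rewrite (adjoint_op0 _ _ _ bndT) addr0.
exists (a *: h + k), (a *: h' + k'); split; first exact: (sG.2 a _ _ Gf Gg).
  by rewrite !linearP hT kT.
rewrite !linearP (adjoint_op_linear _ _ _ bndT) /=.
by apply: injective_projections; rewrite //= scalerDr addrACA.
Qed.

Lemma Gamma_T_green : green_identity (Gamma_T D G T).
Proof.
move=> f p g q [h [h' [Gf hT /= ->]]] [k [k' [Gg kT /= ->]]].
have [greenG _ _] := condG; rewrite /green (greenG _ _ _ _ Gf Gg) /=.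
rewrite (inner_pr D h') (inner_pr D h) hT kT innerDl innerDr.
rewrite (innerC (adjoint_op T _)) !(adjoint_opP _ _ _ bndT) -innerC; ring.
Qed.

(** [h_2 = 0] and [h_1 = T h_2] give [h = 0]; conversely [h = 0] satisfies the
    coupling. *)
Lemma Gamma_T_rker0 : rker (Gamma0 (Gamma_T D G T)) = rker (Gamma0 G).
Proof.
apply/seteqP; split=> f.
  move=> [y [h [h' [Gf hT [h2 _]]]]]; exists h'.
  suff <- : h = 0 by [].
  by rewrite -(in_pr D h) hT -h2 !linear0 addr0.
move=> [h' Gf]; exists (adjoint_op T (pr1 D h') + pr2 D h'), 0, h'.
by rewrite /= !linear0.
Qed.

Lemma Gamma_T_condition_B : condition_B (Gamma_T D G T).
Proof.
have [_ ranG saG] := condG.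
split; [exact: Gamma_T_green| |by rewrite Gamma_T_rker0].
apply/seteqP; split=> // x _.
have : rran (Gamma0 G) (in1 D (T x) + in2 D x) by rewrite ranG.
move=> [f [h' Gf]]; have [p1 p2] := pr_in D (T x) x.
exists f, (adjoint_op T (pr1 D h') + pr2 D h'), (in1 D (T x) + in2 D x), h'.
by rewrite p1 p2.
Qed.

Lemma relation_HT_rker : rdom G `<=` adjoint S ->
  relation_HT D S G T = rker (Gamma_T D G T).
Proof.
move=> domG; apply/seteqP; split=> f.
  move=> [_ [h [h' [Gf h0 h2']]]]; exists h, h'.
  by rewrite h2' subrr h0 !linear0; split=> //; rewrite -h0.
move=> [h [h' [Gf hT [h2 h2']]]].
have h0 : h = 0 by rewrite -(in_pr D h) hT -h2 !linear0 addr0.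
split; first by apply: domG; exists (h, h').
exists h, h'; split=> //.
by apply/eqP; rewrite -subr_eq0 opprK addrC -h2'.
Qed.

(** The first boundary value [x] for [Gamma_T] is the boundary value
    [T x (+) x] for [G], so the gamma-field and the Weyl function of [G] at
    [T x (+) x] give both parts of the answer by linearity. *)
Lemma Gamma_T_weyl_pairE (l : R[i]) n x y : complex.Im l != 0 ->
  Gamma_T D G T ((n, l *: n), (x, y)) <->
  n = gamma1 D G l (T x) + gamma2 D G l x /\
  y = adjoint_op T (M11 D G l (T x)) + adjoint_op T (M12 D G l x)
      + M21 D G l (T x) + M22 D G l x.
Proof.
move=> l0.
have [n1 [y1 G1]] := gamma_field_total linG condG l (in1 D (T x)) l0.
have [n2 [y2 G2]] := gamma_field_total linG condG l (in2 D x) l0.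
have G12 : G ((n1 + n2, l *: n1 + l *: n2), (in1 D (T x) + in2 D x, y1 + y2)).
  exact: (subspaceD sG _ _ G1 G2).
rewrite -scalerDr in G12.
have [g1 m1] := weyl_pairE linG condG _ _ _ _ l0 G1.
have [g2 m2] := weyl_pairE linG condG _ _ _ _ l0 G2.
have [p1 p2] := pr_in D (T x) x.
have -> : gamma1 D G l (T x) + gamma2 D G l x = n1 + n2.
  by rewrite /gamma1 /gamma2 /= g1 g2.
have -> : adjoint_op T (M11 D G l (T x)) + adjoint_op T (M12 D G l x)
      + M21 D G l (T x) + M22 D G l x =
    adjoint_op T (pr1 D (y1 + y2)) + pr2 D (y1 + y2).
  rewrite /M11 /M12 /M21 /M22 /= m1 m2 !linearD -addrA; congr (_ + _).
  have := adjoint_op_linear _ _ _ bndT 1 (pr1 D y1) (pr1 D y2).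
  by rewrite !scale1r.
split=> [[h [h' [Gn hT [xh ->]]]]|[-> ->]]; last first.
  by exists (in1 D (T x) + in2 D x), (y1 + y2); rewrite p1 p2.
have E : in1 D (T x) + in2 D x = h by rewrite xh -hT in_pr.
rewrite E in G12.
by have [-> ->] := weyl_pair_unique linG condG _ _ _ _ _ _ l0 Gn G12.
Qed.

End TransformedRelation.

Theorem proposition5p4 (R : realType) (F H H1 H2 : hilbertType R)
    (S : set (F * F)) (G : set ((F * F) * (H * H)))
    (D : orthogonal_decomposition H H1 H2) (T : {linear H2 -> H1})
    (sepF : separable_space F)
    (linS : linear_relation S) (opS : single_valued S)
    (closedS : closed S) (symS : symmetric_relation S)
    (bndG : boundary_relation S G) (condG : condition_B G)
    (bndT : bounded_near T (nbhs 0)) :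
  [/\ [/\ linear_relation (relation_HT D S G T),
          closed (relation_HT D S G T),
          symmetric_relation (relation_HT D S G T) &
          equal_defect_numbers (relation_HT D S G T)],
      boundary_relation (relation_HT D S G T) (Gamma_T D G T) /\
      condition_B (Gamma_T D G T),
      rdom (Gamma_T D G T) =
        [set f | adjoint S f /\
           exists h h', G (f, (h, h')) /\ pr1 D h = T (pr2 D h)],
      forall l : R[i], complex.Im l != 0 ->
        gamma_field (Gamma_T D G T) l =
        graph (fun x => gamma1 D G l (T x) + gamma2 D G l x) &
      forall l : R[i], complex.Im l != 0 ->
        weyl_family (Gamma_T D G T) l =
        graph (fun x => adjoint_op T (M11 D G l (T x))
                        + adjoint_op T (M12 D G l x)
                        + M21 D G l (T x) + M22 D G l x)].
Proof.
have [linG [domG _] _ _] := bndG.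
have linT := Gamma_T_linear linG bndT : linear_relation (Gamma_T D G T).
have condT := Gamma_T_condition_B condG bndT : condition_B (Gamma_T D G T).
rewrite (relation_HT_rker domG).
split.
- split; [exact/linear_relationP/rker_subspace| | |].
  + by rewrite (rker_adjoint_rdom linT condT); apply: adjoint_closed.
  + exact: rker_symmetric.
  + by apply: (selfadjoint_extension_equal_defect _ _ _ (rker_sub_A0)); case: condT.
- by split=> //; apply: condition_B_boundary_relation.
- apply/seteqP; split=> f.
    move=> [p [h [h' [Gf hT _]]]]; split; last by exists h, h'.
    by apply: domG; exists (h, h').
  move=> [_ [h [h' [Gf hT]]]].
  by exists (pr2 D h, adjoint_op T (pr1 D h') + pr2 D h'), h, h'.
- move=> l l0; apply/seteqP; split=> -[x n].
    by move=> [y /(Gamma_T_weyl_pairE linG condG bndT _ _ _ _ l0)[]].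
  move=> nE; eexists; apply/(Gamma_T_weyl_pairE linG condG bndT _ _ _ _ l0).
  by split; first exact: nE.
- move=> l l0; apply/seteqP; split=> -[x y].
    by move=> [n /(Gamma_T_weyl_pairE linG condG bndT _ _ _ _ l0)[]].
  move=> yE; eexists; apply/(Gamma_T_weyl_pairE linG condG bndT _ _ _ _ l0).
  by split; last exact: yE.
Qed.
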